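(* Let $c>0$ be fixed, and let $G$ range over a sequence of digraphs, where $G$ has $n$ vertices and $m\ge c n^2$ edges with $n\to\infty$ along the sequence. Then $\tau(G)=o(m)$ (that is, $G$ has quasirandom direction with respect to its underlying undirected graph $\overline{G}$) if and only if $$\beta(G)=\frac{m}{2}-o(m).$$
   Context: All digraphs are finite and oriented: no loops, no parallel edges, no antiparallel edges. The underlying undirected graph $\overline{G}$ is obtained by replacing directed edges by undirected edges. For a digraph $G=(V,E)$ and (not necessarily disjoint) $A,B\subset V$, $e(A,B)=|\{(a,b)\in E: a\in A, b\in B\}|$. The directional discrepancy is $\tau(G)=\max_{A,B\subset V}(e(A,B)-e(B,A))$. A digraph $G$ with $m$ edges is said to have quasirandom direction with respect to $\overline{G}$ if $\tau(G)=o(m)$. A feedback arc set of $G$ is a set $S\subset E$ such that $(V,E\setminus S)$ has no directed cycles; $\beta(G)$ is the minimum size of a feedback arc set. *)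

(* Defs.v *)
From HB Require Import structures.
From mathcomp Require Import all_boot all_order all_algebra.
From mathcomp Require Import all_classical all_reals all_analysis.

Set Implicit Arguments.
Unset Strict Implicit.
Unset Printing Implicit Defensive.

Import Order.TTheory GRing.Theory Num.Theory.
Import numFieldNormedType.Exports.

Local Open Scope ring_scope.

Record digraph := Digraph {
  vertex : finType;
  edges : {set vertex * vertex};
  no_loop : forall x, (x, x) \notin edges;
  no_antiparallel : forall x y, (x, y) \in edges -> (y, x) \notin edges
}.

Definition num_vertices (G : digraph) : nat := #|vertex G|.

Definition num_edges (G : digraph) : nat := #|edges G|.

Definition edges_between (G : digraph) (A B : {set vertex G}) : nat :=
  #|[set u in edges G | (u.1 \in A) && (u.2 \in B)]|.

(* The default value 0 of the iterated maximum is attained at A = B. *)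
Definition tau (G : digraph) : int :=
  \big[Order.max/0]_(A : {set vertex G}) \big[Order.max/0]_(B : {set vertex G})
    ((edges_between A B)%:Z - (edges_between B A)%:Z).

Definition has_directed_cycle (V : finType) (E : {set V * V}) : Prop :=
  exists c : seq V, c <> [::] /\ ucycle [rel x y | (x, y) \in E] c.

Definition feedback_arc_set (G : digraph) (S : {set vertex G * vertex G}) :
    Prop :=
  S \subset edges G /\ ~ has_directed_cycle (edges G :\: S).

Lemma feedback_arc_set_edges (G : digraph) : feedback_arc_set (edges G).
Proof.
split=> // -[[|x p] [// _ /andP[]]].
by rewrite finset.setDv; case: p => [|y p] /=; rewrite inE.
Qed.

(* The minimum is genuine: its default point [edges G] is a feedback arc set
   by [feedback_arc_set_edges]. *)
Definition beta (G : digraph) : nat :=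
  #|[arg min_(S < edges G | `[< feedback_arc_set S >]) #|S|]|.

Local Open Scope classical_set_scope.

Definition quasirandom_direction (R : realType) (G : nat -> digraph) : Prop :=
  (fun k => (tau (G k))%:~R : R) =o_\oo (fun k => (num_edges (G k))%:R : R).

(* Main.v *)
Require Import Defs.
From HB Require Import structures.
From mathcomp Require Import all_boot all_order all_algebra.
From mathcomp Require Import all_classical all_reals all_analysis.
From mathcomp Require Import zify ring lra.

Set Implicit Arguments.
Unset Strict Implicit.
Unset Printing Implicit Defensive.

Import Order.TTheory GRing.Theory Num.Theory.
Import numFieldNormedType.Exports.

Local Open Scope ring_scope.

(** Everything follows from two inequalities between tau and the excess
    [m - 2 * beta], valid for every digraph with n vertices and m edges and
    every block size [q > 0]:

      [tau <= m - 2 * beta <= (n %/ q + 1) * tau + n * q].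

    The excess is the largest value, over the linear orders of the vertices,
    of the number of forward edges minus the number of backward edges: the
    backward edges of an order form a feedback arc set, and conversely an
    acyclic digraph can be sorted topologically.

    For the left inequality ([tau_le_num_edges_sub_beta]), let A and B attain
    tau. Order the vertices by the blocks A \ B, A :&: B, B \ A, with the
    other vertices either all first or all last, and with opposite orders
    inside the blocks in these two cases. Averaging over the two orders, the
    contributions of edges inside a block or meeting the outside cancel, and
    what is left is exactly [e(A,B) - e(B,A)]. So one of the two orders has at
    least tau more forward edges than backward edges.

    For the right inequality ([num_edges_sub_beta_le_tau]), take a topological
    order of what is left after deleting a minimum feedback arc set, and cut
    it into [n %/ q + 1] intervals of at most q vertices. The edges from one
    interval to the union of the later ones exceed those in the other
    direction by at most tau, and at most [n * q] edges lie inside intervals.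

    Intervals of length about [d * n] turn the right inequality into
    [m - 2 * beta <= (1 / d + 1) * tau + 2 * d * n ^ 2]. By density the last
    term is at most [(2 * d / c) * m], so letting tau/m tend to 0 first and
    d afterwards makes the excess o(m). *)

(** * Extremal characterizations of tau and beta *)

Lemma tau_ge (G : digraph) (A B : {set vertex G}) :
  (edges_between A B)%:Z - (edges_between B A)%:Z <= tau G.
Proof.
apply: le_trans (le_bigmax _ _ A).
exact: (le_bigmax _
  (fun B => (edges_between A B)%:Z - (edges_between B A)%:Z) B).
Qed.

Lemma tau_ge0 (G : digraph) : 0 <= tau G.
Proof.
by have := tau_ge (finset.set0 : {set vertex G}) finset.set0; rewrite subrr.
Qed.

Lemma tau_le (G : digraph) (t : int) : 0 <= t ->
  (forall A B : {set vertex G},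
     (edges_between A B)%:Z - (edges_between B A)%:Z <= t) -> tau G <= t.
Proof. by move=> t0 le_t; apply: bigmax_le => // A _; apply: bigmax_le. Qed.

Lemma beta_le (G : digraph) (S : {set vertex G * vertex G}) :
  feedback_arc_set S -> (beta G <= #|S|)%N.
Proof.
move=> fasS; rewrite /beta; case: arg_minnP => [|T _ minT].
  exact/asboolP/feedback_arc_set_edges.
exact/minT/asboolP.
Qed.

Lemma beta_attained (G : digraph) :
  exists2 S : {set vertex G * vertex G}, feedback_arc_set S & beta G = #|S|.
Proof.
rewrite /beta; case: arg_minnP => [|S /asboolP fasS _]; last by exists S.
exact/asboolP/feedback_arc_set_edges.
Qed.

(** Every inequality between edge counts below is proved edge by edge, which is
    why the counts are turned into sums of indicators over the edges. *)
Lemma edges_betweenE (G : digraph) (A B : {set vertex G}) :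
  edges_between A B = (\sum_(u in edges G) ((u.1 \in A) && (u.2 \in B)))%N.
Proof.
rewrite /edges_between cardsE -sum1_card big_mkcondr /=.
by apply: eq_bigr => u _; case: (_ && _).
Qed.

Lemma num_edgesE (G : digraph) : num_edges G = (\sum_(u in edges G) 1)%N.
Proof. by rewrite sum1_card. Qed.

(** * Vertex orders and feedback arc sets *)

(** A linear order is encoded by a key with natural values. Edges between
    vertices with equal keys count as backward, so that the forward edges are
    acyclic for every key, injective or not. *)
Definition backward_edges (G : digraph) (r : vertex G -> nat) :
    {set vertex G * vertex G} :=
  [set u in edges G | ~~ (r u.1 < r u.2)%N].

Lemma card_backward_edges (G : digraph) (r : vertex G -> nat) :
  #|backward_edges r| = (\sum_(u in edges G) ~~ (r u.1 < r u.2))%N.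
Proof.
rewrite cardsE -sum1_card big_mkcondr /=.
by apply: eq_bigr => u _; case: (~~ _).
Qed.

(** Along a directed cycle of forward edges the key would strictly increase
    and come back to its initial value. *)
Lemma backward_edges_feedback (G : digraph) (r : vertex G -> nat) :
  feedback_arc_set (backward_edges r).
Proof.
split; first by apply/fintype.subsetP => u; rewrite inE => /andP[].
case=> -[|x p] [// _ /andP[cyc _]].
have : path (relpre r ltn) x (rcons p x).
  move: cyc; rewrite /=; apply: sub_path => y z /=.
  by rewrite !inE /= => /andP[+ yzE]; rewrite yzE /= negbK.
move/order_path_min => /(_ (fun _ _ _ => @ltn_trans _ _ _))/allP/(_ x).
by rewrite mem_rcons mem_head /= ltnn => /(_ isT).
Qed.

(** In an acyclic digraph the number of ancestors of a vertex strictly increases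
    along edges, so sorting the vertices by it gives a topological order. The
    key is the position in the sorted list: this breaks ties, which the count
    of vertices in a block needs. *)
Lemma acyclic_topological_order (V : finType) (E : {set V * V}) :
  ~ has_directed_cycle E ->
  exists r : V -> nat, [/\ injective r, (forall x, r x < #|V|)%N
    & forall x y, (x, y) \in E -> (r x < r y)%N].
Proof.
move=> acyc; pose e := [rel x y | (x, y) \in E].
pose anc x := #|[set y | connect e y x]|.
have ancP x y : (x, y) \in E -> (anc x < anc y)%N.
  move=> xyE; apply: proper_card; apply/properP; split.
    apply/fintype.subsetP => z; rewrite !inE => zx.
    exact: connect_trans zx (connect1 _).
  exists y; rewrite !inE ?connect0 //; apply/negP => /connectP[p].
  case/shortenP => p' pth uniq_p _ defx; apply: acyc.
  (* A path from y to x is closed into a cycle by the edge (x, y). *)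
  exists (y :: p'); split=> //; apply/andP; split=> //=.
  by rewrite rcons_path pth -defx.
pose s := sort (relpre anc leq) (enum V).
have sV x : x \in s by rewrite mem_sort mem_enum.
exists (index^~ s); split.
- by move=> x y /(congr1 (nth x s)); rewrite !nth_index.
- by move=> x; rewrite cardE -(size_sort (relpre anc leq)) index_mem.
move=> x y xyE; have ltxy := ancP _ _ xyE.
rewrite ltnNge; apply/negP; rewrite leq_eqVlt => /orP[/eqP eqi|lti].
  move/(congr1 (nth x s)): eqi; rewrite !nth_index // => eqyx.
  by rewrite eqyx ltnn in ltxy.
have s_sorted : sorted (relpre anc leq) s.
  by apply: sort_sorted => a b; apply: leq_total.
have /= := sorted_ltn_index (fun _ _ _ => @leq_trans _ _ _) s_sorted
  _ _ (sV _) (sV _) lti.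
by rewrite leqNgt ltxy.
Qed.

(** * The excess is at least tau *)

(** Averaging over two orders loses nothing, even when A and B overlap: give an
    edge the value 1 in an order if it is forward and -1 if it is backward; its
    mean value in the two orders is then exactly its contribution to
    [e(A,B) - e(B,A)]. *)
Lemma tau_le_num_edges_sub_beta (G : digraph) :
  tau G <= (num_edges G)%:Z - (beta G).*2%:Z.
Proof.
have fas r := beta_le (@backward_edges_feedback G r).
suff key (A B : {set vertex G}) :
    ((beta G).*2 + edges_between A B <= num_edges G + edges_between B A)%N.
  apply: tau_le => [|A B]; last by have := key A B; lia.
  by have := key finset.set0 finset.set0; lia.
pose N := #|vertex G|; pose i (x : vertex G) : nat := enum_rank x.
have iN x : (i x < N)%N by apply: ltn_ord.
(* The blocks A \ B, A :&: B, B \ A get levels 1, 2, 3; the parameter d is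
   the level of the other vertices. *)
pose lev d x : nat :=
  if x \in A then (if x \in B then 2 else 1)%N else if x \in B then 3%N else d.
(* Lexicographic keys. The tie-breaking order is reversed in r2, so that an edge
   inside a block is backward in exactly one of the two orders. *)
pose r1 x := (lev 0 x * N + i x)%N.
pose r2 x := (lev 4 x * N + (N - i x))%N.
have := leq_add (fas r1) (fas r2).
rewrite addnn => /leq_trans le_back.
apply: (@leq_trans (#|backward_edges r1| + #|backward_edges r2|
  + edges_between A B)%N); first by rewrite leq_add2r le_back.
rewrite !card_backward_edges !edges_betweenE num_edgesE -!big_split /=.
apply: leq_sum => -[x y] /= xyE.
have : i x != i y.
  apply: contraTneq xyE => /ord_inj/enum_rank_inj ->; exact: no_loop.
have := iN x; have := iN y; rewrite /r1 /r2 /lev.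
by case: (x \in A); case: (x \in B); case: (y \in A); case: (y \in B);
  rewrite /=; lia.
Qed.

(** * The excess is controlled by tau *)

Lemma card_block (V : finType) (r : V -> nat) (q i : nat) : (0 < q)%N ->
  injective r -> (#|[set x | r x %/ q == i]| <= q)%N.
Proof.
move=> q0 inj_r; set D := [set x | _].
have : uniq [seq (r x %% q)%N | x in D].
  rewrite map_inj_in_uniq ?enum_uniq // => x y.
  rewrite !mem_enum !inE => /eqP qx /eqP qy modE; apply: inj_r.
  by rewrite (divn_eq (r x) q) (divn_eq (r y) q) qx qy modE.
move=> uniqD; rewrite cardE -(size_map (fun x => (r x %% q)%N)).
rewrite -[leqRHS](size_iota 0); apply: uniq_leq_size => // m.
by case/mapP => x _ ->; rewrite mem_iota /= add0n ltn_mod.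
Qed.

Lemma num_edges_in_blocks (G : digraph) (r : vertex G -> nat) (q : nat) :
  (0 < q)%N -> injective r ->
  (\sum_(u in edges G) (r u.1 %/ q == r u.2 %/ q) <= num_vertices G * q)%N.
Proof.
move=> q0 inj_r.
apply: (@leq_trans (\sum_(u : vertex G * vertex G) (r u.1 %/ q == r u.2 %/ q))%N).
  by rewrite [leqRHS](bigID (mem (edges G))) leq_addr.
rewrite -(pair_bigA _ (fun x y => (r x %/ q == r y %/ q)%N : nat)) /=.
rewrite /num_vertices -sum_nat_const; apply: leq_sum => x _.
apply: leq_trans (card_block (r x %/ q) q0 inj_r).
rewrite cardsE -sum1_card [leqRHS]big_mkcond /=.
by apply: leq_sum => y _; rewrite eq_sym unfold_in -[eqn _ _]/(_ == _); case: eqP.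
Qed.

Lemma ltn_count (t a b : nat) : (a < t)%N ->
  ((a < b)%N : nat) = (\sum_(i < t) ((a == i) && (i < b)))%N.
Proof.
move=> lt_at; rewrite (bigD1 (Ordinal lt_at)) //= eqxx /= big1 ?addn0 // => i.
by rewrite -val_eqE /= eq_sym => /negbTE ->.
Qed.

(** Edges between different blocks are counted as edges from a block [A i] to
    the union [B i] of the later blocks: this uses tau only once per block,
    rather than once per pair of blocks. *)
Lemma num_edges_sub_beta_le_tau (G : digraph) (q : nat) : (0 < q)%N ->
  (num_edges G)%:Z - (beta G).*2%:Z <=
  (num_vertices G %/ q).+1%:Z * tau G + (num_vertices G * q)%:Z.
Proof.
move=> q0; have [S [_ acyc] ->] := beta_attained G.
have [r [inj_r r_lt r_mono]] := acyclic_topological_order acyc.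
set t := (num_vertices G %/ q).+1; pose k x := (r x %/ q)%N.
have kt x : (k x < t)%N by rewrite ltnS leq_div2r // ltnW // r_lt.
pose A i := [set x | k x == i]; pose B i := [set x | (i < k x)%N].
(* An edge outside S is forward, so the backward edges lie in S. *)
have back_le : (\sum_(u in edges G) ~~ (r u.1 < r u.2) <= #|S|)%N.
  rewrite -card_backward_edges; apply/subset_leq_card/fintype.subsetP => -[x y].
  rewrite inE /= => /andP[xyE]; apply: contraNT => xyS.
  by apply: r_mono; rewrite inE xyS.
have fwd : (\sum_(u in edges G) (k u.1 < k u.2) =
            \sum_(i < t) edges_between (A i) (B i))%N.
  under [RHS]eq_bigr do rewrite edges_betweenE.
  rewrite exchange_big /=; apply: eq_bigr => u _.
  by rewrite (ltn_count _ (kt _)); apply: eq_bigr => i _; rewrite !inE.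
have bwd : (\sum_(u in edges G) (k u.2 < k u.1) =
            \sum_(i < t) edges_between (B i) (A i))%N.
  under [RHS]eq_bigr do rewrite edges_betweenE.
  rewrite exchange_big /=; apply: eq_bigr => u _.
  by rewrite (ltn_count _ (kt _)); apply: eq_bigr => i _; rewrite !inE andbC.
(* An edge is worth 1. If it is forward, its endpoints lie in blocks in weakly
   increasing order; if it is backward, it counts twice on the right. *)
have count : (num_edges G + \sum_(u in edges G) (k u.2 < k u.1) <=
    (\sum_(u in edges G) ~~ (r u.1 < r u.2)).*2 +
    \sum_(u in edges G) (k u.1 < k u.2) +
    \sum_(u in edges G) (k u.1 == k u.2))%N.
  rewrite num_edgesE -addnn -!big_split /=; apply: leq_sum => -[x y] /= _.
  case: (ltnP (r x) (r y)) => [/ltnW/(leq_div2r q)|_]; rewrite /= -/(k x) -/(k y).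
    by case: ltngtP.
  by case: ltngtP.
have discrepancy : (\sum_(i < t) edges_between (A i) (B i))%N%:Z -
    (\sum_(i < t) edges_between (B i) (A i))%N%:Z <= t%:Z * tau G.
  rewrite !(raddf_sum Posz) /= -sumrB.
  rewrite -[t%:Z]natz -[t in t%:R]card_ord mulr_natl -sumr_const.
  by apply: ler_sum => i _; apply: tau_ge.
have in_blocks : (\sum_(u in edges G) (k u.1 == k u.2) <= num_vertices G * q)%N.
  exact: num_edges_in_blocks.
rewrite fwd bwd in count; lia.
Qed.

Local Open Scope classical_set_scope.

Theorem theorem1p9 (R : realType) (c : R) (G : nat -> digraph)
    (c_gt0 : 0 < c)
    (vertices_oo : num_vertices (G k) @[k --> \oo] --> \oo)
    (dense : forall k, c * (num_vertices (G k))%:R ^+ 2 <= (num_edges (G k))%:R) :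
  quasirandom_direction R G <->
  (fun k => (beta (G k))%:R : R) =
    (fun k => (num_edges (G k))%:R / 2 : R)
    +o_\oo (fun k => (num_edges (G k))%:R : R).
Proof.
pose n k : R := (num_vertices (G k))%:R.
pose m k : R := (num_edges (G k))%:R.
pose b k : R := (beta (G k))%:R.
pose t k : R := (tau (G k))%:~R.
have t_ge0 k : 0 <= t k by rewrite ler0z tau_ge0.
have t_le k : t k <= m k - 2 * b k.
  have := tau_le_num_edges_sub_beta (G k).
  rewrite -(ler_int R) intrB -!pmulrn -mul2n natrM; exact.
have le_t k q : (0 < q)%N ->
    m k - 2 * b k <= (n k / q%:R + 1) * t k + n k * q%:R.
  move=> q0; have := num_edges_sub_beta_le_tau (G k) q0.
  rewrite -(ler_int R) intrB intrD intrM -!pmulrn -mul2n !natrM.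
  move=> /le_trans; apply; rewrite lerD2r ler_wpM2r ?ler0z ?tau_ge0 //.
  rewrite -natr1 lerD2r ler_pdivlMr ?ltr0n // -natrM ler_nat.
  exact: leq_divM.
split.
  move=> /eqoP quasi; apply/eqaddoP => eps eps0.
  (* With blocks of at most 2 * d * n vertices, the term n * q of the upper
     bound is at most 2 * d * n ^ 2 <= (2 * d / c) * m = eps * m. *)
  pose d := c * eps / 2; have d0 : 0 < d by rewrite divr_gt0 ?mulr_gt0.
  have dV0 : 0 < d^-1 by rewrite invr_gt0.
  have e1 : 0 < eps / (d^-1 + 1) by rewrite divr_gt0 ?addr_gt0.
  near=> k.
  have tk : t k <= eps / (d^-1 + 1) * m k.
    rewrite -[t k]ger0_norm // -[m k]ger0_norm ?ler0n //.
    by near: k; apply: quasi.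
  have nk : d^-1 <= n k.
    apply: ltW; apply: lt_le_trans (truncnS_gt _) _.
    by rewrite ler_nat; near: k; apply: (vertices_oo _ (nbhs_infty_ge _)).
  have n0 : 0 < n k by apply: lt_le_trans nk.
  (* The block size satisfies d * n < q <= 2 * d * n, where the upper bound
     uses 1 <= d * n. *)
  pose q := (Num.trunc (d * n k)).+1.
  have dn0 : 0 < d * n k by rewrite mulr_gt0.
  have dn1 : 1 <= d * n k by rewrite -ler_pdivrMl // mulr1.
  have /andP[q_le q_gt] := truncn_itv (ltW dn0).
  have {}q_le : q%:R <= 2 * (d * n k) by rewrite /q -natr1; lra.
  have nq : n k / q%:R <= d^-1.
    by rewrite ler_pdivrMr ?ltr0n // ler_pdivlMl // ltW.
  have bnd := le_t k q isT.
  have bnd1 : (n k / q%:R + 1) * t k <= eps * m k.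
    apply: (@le_trans _ _ ((d^-1 + 1) * t k));
      first by rewrite ler_wpM2r // lerD2r.
    rewrite -ler_pdivlMl ?addr_gt0 // mulrA [_^-1 * eps]mulrC //.
  have bnd2 : n k * q%:R <= eps * m k.
    apply: (@le_trans _ _ (n k * (2 * (d * n k)))); first by rewrite ler_pM2l.
    rewrite (_ : n k * _ = eps * (c * n k ^+ 2)); last by rewrite /d; field.
    by rewrite ler_pM2l //; apply: dense.
  rewrite -[X in _ <= eps * X]/(`|m k|) [`|m k|]ger0_norm ?ler0n //.
  rewrite (_ : (_ - _) k = b k - m k / 2) // ler_norml.
  have := t_le k; have := t_ge0 k; lra.
move=> /eqaddoP half; apply/eqoP => eps eps0.
have e2 : 0 < eps / 2 by rewrite divr_gt0.
near=> k.
have half_k : `|b k - m k / 2| <= eps / 2 * `|m k|.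
  by near: k; apply: half.
rewrite -[X in X <= _]/(`|t k|) -[X in _ <= eps * X]/(`|m k|).
move: half_k; rewrite (ger0_norm (t_ge0 k)).
rewrite [`|m k|]ger0_norm ?ler0n // ler_norml.
have := t_le k; lra.
Unshelve. all: by end_near.
Qed.
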